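(* Let $d\geq 2$, and let $\mathbb{R}^d=C_1\sqcup\cdots\sqcup C_r$ be a finite colouring (a partition into finitely many arbitrary subsets; no measurability is assumed). Then there exists $1\leq i_0\leq r$ such that $\operatorname{TraceSpec}(C_{i_0})=\mathbb{R}^{d-1}$. That is, for every $(a_2,\ldots,a_d)\in\mathbb{R}^{d-1}$ there is an ordered tuple $\mathbf v=(v_0,\ldots,v_d)\in C_{i_0}^{d+1}$ with $(c_2(A_{\mathbf v}),\ldots,c_d(A_{\mathbf v}))=(a_2,\ldots,a_d)$.
   Context: For $A\in\operatorname{Mat}_d(\mathbb{R})$, the characteristic coefficients $c_1(A),\ldots,c_d(A)$ are defined by $\det(xI-A)=x^d-c_1(A)x^{d-1}+c_2(A)x^{d-2}-\cdots+(-1)^dc_d(A)$; equivalently $c_k(A)$ is the sum of the $k\times k$ principal minors of $A$. Write $\mathbf{Tr}(A)=(c_2(A),\ldots,c_d(A))\in\mathbb{R}^{d-1}$. For an ordered tuple $\mathbf v=(v_0,\ldots,v_d)$ of vectors in $\mathbb{R}^d$ (not necessarily affinely independent), the edge matrix is $A_{\mathbf v}=[\,v_1-v_0\ \cdots\ v_d-v_0\,]$, the $d\times d$ matrix with columns $v_j-v_0$. For $E\subseteq\mathbb{R}^d$, the trace spectrum is $\operatorname{TraceSpec}(E)=\{\mathbf{Tr}(A_{\mathbf v}):\mathbf v=(v_0,\ldots,v_d)\in E^{d+1}\}$. *)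

(* Defs.v *)
From mathcomp Require Import all_boot all_order all_algebra.
From mathcomp Require Import boolp classical_sets reals.

Set Implicit Arguments.
Unset Strict Implicit.
Unset Printing Implicit Defensive.

Import Order.TTheory GRing.Theory Num.Theory.

Local Open Scope classical_set_scope.
Local Open Scope ring_scope.

(* c_k(A), normalised by
   det(xI - A) = x^d - c_1(A) x^(d-1) + c_2(A) x^(d-2) - ... + (-1)^d c_d(A)
   (see char_poly_charcoef); only meaningful for k <= d. *)
Definition charcoef (R : comNzRingType) (d : nat) (k : nat) (A : 'M[R]_d) : R :=
  (-1) ^+ k * (char_poly A)`_(d - k).

Lemma char_poly_charcoef (R : comNzRingType) (d : nat) (A : 'M[R]_d) :
  char_poly A = \sum_(k < d.+1) ((-1) ^+ k * charcoef k A) *: 'X^(d - k).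
Proof.
rewrite -[LHS]coefK size_char_poly poly_def (reindex_inj rev_ord_inj) /=.
apply: eq_bigr => k _; rewrite subSS /charcoef mulrA -exprD addnn -mul2n.
by rewrite exprM sqrrN expr1n expr1n mul1r.
Qed.

Lemma charcoef0 (R : comNzRingType) (d : nat) (A : 'M[R]_d) : charcoef 0 A = 1.
Proof.
rewrite /charcoef expr0 mul1r subn0.
by have /monicP := char_poly_monic A; rewrite lead_coefE size_char_poly.
Qed.

(* (c_2(A), ..., c_d(A)): the j-th entry, counted from 0, is c_(j+2)(A). *)
Definition trace_vector (R : comNzRingType) (d : nat) (A : 'M[R]_d) :
    'rV[R]_d.-1 :=
  \row_(j < d.-1) charcoef j.+2 A.

(* Column j, counted from 0, is v_(j+1) - v_0, since lift ord0 j = j + 1. *)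
Definition edge_matrix (R : comNzRingType) (d : nat)
    (v : 'I_d.+1 -> 'cV[R]_d) : 'M[R]_d :=
  \matrix_(i < d, j < d) (v (lift ord0 j) - v ord0) i 0.

Definition TraceSpec (R : comNzRingType) (d : nat) (E : set 'cV[R]_d) :
    set 'rV[R]_d.-1 :=
  [set trace_vector (edge_matrix v) | v in
     [set v : 'I_d.+1 -> 'cV[R]_d | forall i, E (v i)]].

(* Main.v *)
Require Import Defs.
From mathcomp Require Import all_boot all_order all_algebra.
From mathcomp Require Import boolp classical_sets reals.
From mathcomp Require Import ring.

Set Implicit Arguments.
Unset Strict Implicit.
Unset Printing Implicit Defensive.

Import Order.TTheory GRing.Theory Num.Theory.

Local Open Scope classical_set_scope.
Local Open Scope ring_scope.

(** Write d = n + 2, let e be the last of the d coordinates, and suppose that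
    every colour i misses some target a(i); the a(i) are arbitrary and may
    differ from colour to colour. A monochromatic tuple realising the target
    of its own colour is constructed, which is absurd.

    The tuple has a companion-like edge matrix: t_1, ..., t_(n+1) on the
    superdiagonal, y_0, ..., y_(n+1) in the last row, zero elsewhere. Its
    characteristic polynomial is
      x^(n+2) - sum_j y_j t_(j+1) ... t_(n+1) x^j,
    so c_2, ..., c_d involve y_0, ..., y_n only and y_(n+1) = c_1 is free. Once
    v_0, ..., v_(d-1) share a colour i, the last vertex may be any point of
    colour i on one specific line parallel to the axis e; and given the t_j,
    the values of y_0, ..., y_n are forced by a(i):
      y_j = b_j(i) / (t_(j+1) ... t_(n+1)), with b_j(i) = +- c_(n+2-j).

    To be sure that colour i occurs on the line of v_d, colour each line
    parallel to e by the set of colours that occur on it. The line of v_d is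
    the line of v_0 moved by t_(n+1) along the coordinate before e, so a
    Gallai-type theorem provides a scale s such that the two lines carry the
    same colours whenever t_(n+1) = s X with 0 < X <= L.

    It remains to find v_0 and integers t_1, ..., t_n, X with v_0, ...,
    v_(d-1) of one colour, although y_j is not linear in the t_j. Choose an
    integer t_0 as well and put X = L / (t_0 t_1 ... t_n), where L is a common
    multiple of all the products that may occur. Then
      y_j = t_j * (t_0 ... t_(j-1)) * b_j(i) / (s L),
    so that v_(j+1) - v_0 is t_j times a vector depending only on t_0, ...,
    t_(j-1) and i. Such stars are produced by [nested_gallai], which iterates
    Gallai's theorem [gallai], the colouring used to choose t_j recording the
    original one at all the base points that the earlier stages may need.

    The set of possible multipliers must be bounded before L, hence before the
    vectors themselves, is known. For this reason base points are described by
    words in the names of the directions; the finite set of words is the same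
    for all abelian groups, all vectors and all colourings. *)

(** * Words and product colourings *)

Definition walk (T : Type) (G : zmodType) (w : T -> G) (v : seq T) : G :=
  \sum_(x <- v) w x.

Lemma walk_cat (T : Type) (G : zmodType) (w : T -> G) (u v : seq T) :
  walk w (u ++ v) = walk w u + walk w v.
Proof. exact: big_cat. Qed.

Lemma walk_nseq (T : Type) (G : zmodType) (w : T -> G) (m : nat) (a : T) :
  walk w (nseq m a) = w a *+ m.
Proof. by rewrite /walk big_nseq iter_addr_0. Qed.

(** The product colouring that records the colours at all the translates of x
    by the words of Phi. Two points with equal profiles look alike to every
    argument that only inspects points reached through Phi. *)
Definition profile (T : eqType) (G : zmodType) (K : Type) (w : T -> G)
    (chi : G -> K) (Phi : seq (seq T)) (x : G) : (size Phi).-tuple K :=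
  map_tuple (fun u => chi (x + walk w u)) (in_tuple Phi).

Lemma profile_eq (T : eqType) (G : zmodType) (K : Type) (w : T -> G)
    (chi : G -> K) (Phi : seq (seq T)) (x y : G) (u : seq T) :
  profile w chi Phi x = profile w chi Phi y -> u \in Phi ->
  chi (x + walk w u) = chi (y + walk w u).
Proof. by move=> /(congr1 val)/eq_in_map; apply. Qed.

(** * Gallai's theorem by colour focusing *)
Definition homothet (T : eqType) (G : zmodType) (K : Type) (w : T -> G)
    (chi : G -> K) (D : seq T) (x : G) (m : nat) : Prop :=
  forall a, a \in D -> chi (x + w a *+ m) = chi x.

(** B and Phi are quantified before the group, the directions w and the
    colouring: the directions to be used later depend on these bounds. *)
Definition gallai_property (T : eqType) (D : seq T) (K : finType) : Prop :=
  exists (B : nat) (Phi : seq (seq T)),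
  forall (G : zmodType) (w : T -> G) (chi : G -> K),
  exists (v : seq T) (m : nat),
    [/\ v \in Phi, (0 < m <= B)%N & homothet w chi D (walk w v) m].

(** Homothets of {0} + D of pairwise distinct colours are focused at f when
    completing any of them by the direction a leads to the same point f. If f
    repeats one of their colours, that homothet extends to a :: D; otherwise f
    brings a new colour. To gain one more homothet, apply the result for D to
    a product colouring that sees the entire configuration: the directions of
    D repeat its colours under a translation of multiplier M, so adding M to
    all the multipliers preserves the old colours, moves the focus by M times
    a, and turns the old focus into the base of a homothet of multiplier M. *)
Lemma colour_focusing (T : eqType) (a : T) (D : seq T) (K : finType)
    (IH : forall K' : finType, gallai_property D K') (c : nat) :
  exists (B : nat) (Phi : seq (seq T)),
  forall (G : zmodType) (w : T -> G) (chi : G -> K),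
  (exists (v : seq T) (m : nat),
    [/\ v \in Phi, (0 < m <= B)%N & homothet w chi (a :: D) (walk w v) m])
  \/
  (exists (f : seq T) (s : seq (seq T * nat)),
    [/\ f \in Phi, size s = c,
        uniq (chi (walk w f) :: [seq chi (walk w p.1) | p <- s]) &
        forall p, p \in s ->
          [/\ p.1 \in Phi, (0 < p.2 <= B)%N, homothet w chi D (walk w p.1) p.2
            & walk w p.1 + w a *+ p.2 = walk w f]]).
Proof.
elim: c => [|c [B [Phi IHc]]].
  exists 0, [:: [::]] => G w chi; right; exists [::], [::].
  by split.
(* Psi reaches every vertex of every configuration found by IHc. *)
pose Psi := Phi ++
  [seq x ++ nseq y.1 y.2
     | x <- Phi, y <- [seq (m, l) | m <- iota 0 B.+1, l <- D]].
have [B1 [Phi1 H1]] := IH ((size Psi).-tuple K : finType).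
pose F := [seq f ++ nseq M a | f <- Phi, M <- iota 0 B1.+1].
exists (B + B1), [seq u ++ v | u <- Phi1, v <- Phi ++ F] => G w chi.
have [u [M [uP /andP[M0 MB] hu]]] := H1 G w (profile w chi Psi).
set x := walk w u in hu.
have inPhi v : v \in Phi -> u ++ v \in [seq u ++ v | u <- Phi1, v <- Phi ++ F].
  by move=> vP; apply: allpairs_f => //; rewrite mem_cat vP.
have [[v [m [vP /andP[m0 mB] hv]]]|] := IHc G w (fun y => chi (x + y)).
  left; exists (u ++ v), m; split.
  - exact: inPhi.
  - by rewrite m0 (leq_trans mB) ?leq_addr.
  - by move=> b bD; rewrite walk_cat -addrA; exact: hv.
move=> [f [s [fP ss us hs]]].
pose f' := u ++ (f ++ nseq M a).
pose s' := (u ++ f, M) :: [seq (u ++ p.1, (p.2 + M)%N) | p <- s].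
have walkf' : walk w f' = x + walk w f + w a *+ M.
  by rewrite /f' !walk_cat walk_nseq addrA.
have hs' p : p \in s' ->
    [/\ p.1 \in [seq u ++ v | u <- Phi1, v <- Phi ++ F], (0 < p.2 <= B + B1)%N,
       homothet w chi D (walk w p.1) p.2
     & walk w p.1 + w a *+ p.2 = walk w f'].
  rewrite inE => /predU1P[->|/mapP[q /hs[qP /andP[q0 qB] hq qf] ->]] /=.
    split; [exact: inPhi | by rewrite M0 (leq_trans MB) ?leq_addl | |].
    - move=> l lD; rewrite walk_cat -/x addrAC.
      by apply: profile_eq (hu _ lD) _; rewrite mem_cat fP.
    - by rewrite walkf' walk_cat.
  split; [exact: inPhi | by rewrite addn_gt0 q0 leq_add | |].
  - move=> l lD; rewrite walk_cat -/x -(hq _ lD) mulrnDr.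
    rewrite (_ : x + _ + _ = x + w l *+ M + walk w (q.1 ++ nseq q.2 l)).
      rewrite (profile_eq (hu _ lD)) ?walk_cat ?walk_nseq //.
      rewrite mem_cat; apply/orP; right.
      apply/allpairsP; exists (q.1, (q.2, l)); split=> //.
      by apply/allpairsP; exists (q.2, l); split=> //; rewrite mem_iota.
    by rewrite walk_cat walk_nseq [_ *+ q.2 + _]addrC addrACA.
  - by rewrite walkf' walk_cat -qf mulrnDr -/x !addrA.
have us' : uniq [seq chi (walk w p.1) | p <- s'].
  move: us; rewrite /s' /= -map_comp walk_cat -/x.
  by under [in X in _ -> X]eq_map => p do rewrite /= walk_cat.
have [/mapP[p ps' fp]|fs'] :=
  boolP (chi (walk w f') \in [seq chi (walk w p.1) | p <- s']).
  have [pP pB hp pf] := hs' _ ps'.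
  left; exists p.1, p.2; split=> // l; rewrite inE => /predU1P[->|/hp//].
  by rewrite pf.
right; exists f', s'; split=> //.
- apply: allpairs_f => //; rewrite mem_cat; apply/orP; right.
  by apply: allpairs_f => //; rewrite mem_iota.
- by rewrite /s' /= size_map ss.
- by rewrite cons_uniq fs' us'.
Qed.

(** #|K| focused homothets and their focus would show #|K| + 1 colours. *)
Lemma gallai (T : eqType) (D : seq T) (K : finType) : gallai_property D K.
Proof.
elim: D K => [K|a D IH K].
  by exists 1, [:: [::]] => G w chi; exists [::], 1.
have [B [Phi H]] := colour_focusing a K IH #|K|.
exists B, Phi => G w chi; have [//|[f [s [_ ss us _]]]] := H G w chi.
by have := max_card (mem (chi (walk w f) :: [seq chi (walk w p.1) | p <- s]));
  rewrite (card_uniqP us) /= size_map ss ltnn.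
Qed.

(** A star whose direction at stage j depends on the multipliers of the
    previous stages, and on a parameter in A. The last stage is treated first
    in the proof: all the directions it could use are finitely many, so
    [gallai] gives one multiplier for which they all preserve the product
    colouring over the base points of the previous stages. Those stages then
    take place at the point so obtained. *)
Lemma nested_gallai (A K : finType) (k : nat) :
  exists (Ts : seq (seq nat)) (Phi : seq (seq (seq nat * A))),
    (forall tau, tau \in Ts -> size tau = k /\ all (leq 1) tau) /\
    forall (G : zmodType) (w : seq nat * A -> G) (chi : G -> K),
    exists v tau, [/\ v \in Phi, tau \in Ts &
      forall (j : nat) (i : A), (j < k)%N ->
        chi (walk w v + w (take j tau, i) *+ nth 0 tau j) = chi (walk w v)].
Proof.
elim: k => [|k [Ts [Phi [TsP H]]]].
  exists [:: [::]], [:: [::]]; split=> [tau|G w chi].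
    by rewrite inE => /eqP->.
  by exists [::], [::].
have [B [Phi1 H1]] := gallai [seq (tau, i) | tau <- Ts, i <- enum A]
                             ((size Phi).-tuple K : finType).
exists [seq rcons tau m | tau <- Ts, m <- iota 1 B],
  [seq u ++ v | u <- Phi1, v <- Phi].
split=> [_ /allpairsP[[tau m] /= [/TsP[<- tau1] + ->]]|G w chi].
  by rewrite mem_iota size_rcons all_rcons tau1 andbT => /andP[].
have [u [m [uP mB hu]]] := H1 G w (profile w chi Phi).
have [v [tau [vP tauP hv]]] := H G w (fun y => chi (walk w u + y)).
have [stau _] := TsP _ tauP.
exists (u ++ v), (rcons tau m); split.
- exact: allpairs_f.
- by apply: allpairs_f => //; rewrite mem_iota add1n ltnS.
move=> j i; rewrite ltnS leq_eqVlt => /predU1P[->|jk];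
  rewrite walk_cat nth_rcons.
  rewrite -cats1 take_cat stau ltnn eqxx subnn cats0 addrAC.
  apply: profile_eq vP; apply: hu.
  by apply: allpairs_f => //; rewrite mem_enum.
by rewrite -cats1 take_cat stau jk -addrA hv.
Qed.

(** * Weighted companion matrices *)
Lemma char_poly_intertwined (F : fieldType) (n : nat) (P A C : 'M[F]_n) :
  P \in unitmx -> P *m C = A *m P -> char_poly A = char_poly C.
Proof.
move=> Pu PC; pose P' := map_mx (@polyC F) P.
have dP : \det P' != 0.
  by rewrite det_map_mx polyC_eq0 -unitfE -unitmxE.
apply: (mulIf dP); rewrite /char_poly -det_mulmx mulrC -det_mulmx.
congr (\det _); rewrite /char_poly_mx mulmxBl mulmxBr -!map_mxM PC.
by rewrite scalar_mxC.
Qed.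

(** Conjugation by the diagonal matrix with entries t_(i+1) ... t_n turns the
    superdiagonal into ones and A into the companion matrix of q below. *)
Lemma char_poly_weighted_companion (F : fieldType) (n : nat) (t y : nat -> F)
    (A : 'M[F]_n.+1) :
  (forall j, (j <= n)%N -> t j != 0) ->
  (forall i j : 'I_n.+1, A i j =
     if i == n :> nat then y j else (i.+1 == j :> nat)%:R * t j) ->
  forall j, (j <= n)%N ->
    (char_poly A)`_j = - (y j * \prod_(j.+1 <= l < n.+1) t l).
Proof.
move=> t0 AE j jn.
pose g j := \prod_(j.+1 <= l < n.+1) t l.
have g0 i : g i != 0.
  rewrite prodf_seq_neq0; apply/allP => l.
  by rewrite mem_index_iota => /andP[_ ln]; exact: t0.
have gn : g n = 1 by rewrite /g big_geq.
pose q := 'X^(n.+1) - \poly_(i < n.+1) (y i * g i).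
have sq : size q = n.+2.
  by rewrite size_polyDl size_polyXn // size_polyN ltnS size_poly.
have mq : q \is monic.
  rewrite monicE lead_coefE sq /= coefB coefXn eqxx coef_poly ltnn subr0 //.
have qi i : (i <= n)%N -> q`_i = - (y i * g i).
  by move=> im; rewrite coefB coefXn coef_poly ltnS im ltn_eqF ?ltnS // sub0r.
rewrite -qi //; suff -> : char_poly A = q by [].
pose C : 'M[F]_n.+1 :=
  \matrix_(i, j) if i == n :> nat then - q`_j else (i.+1 == j :> nat)%:R.
have -> : q = char_poly C.
  rewrite -[LHS]companionmxK // /C.
  by rewrite /companionmx sq.
apply: (@char_poly_intertwined F n.+1 (diag_mx (\row_i g i))).
  by rewrite unitmxE det_diag unitfE; apply/prodf_neq0 => i _; rewrite mxE.
apply/matrixP => i k; rewrite mul_diag_mx mul_mx_diag !mxE AE.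
have [->|ine] := eqVneq (i : nat) n.
  by rewrite qi -1?ltnS // gn mul1r opprK.
have [ik|] := eqVneq i.+1 (k : nat); last by rewrite !mul0r mulr0.
have lt_in : (i < n)%N by rewrite ltn_neqAle ine -ltnS ltn_ord.
by rewrite mulr1 mul1r -ik /g [LHS]big_ltn.
Qed.

Lemma trace_vector_weighted_companion (F : fieldType) (n : nat)
    (t y : nat -> F) (A : 'M[F]_n.+2) (a : 'rV[F]_n.+1) :
  (forall j, (j <= n.+1)%N -> t j != 0) ->
  (forall i j : 'I_n.+2, A i j =
     if i == n.+1 :> nat then y j else (i.+1 == j :> nat)%:R * t j) ->
  (forall k : 'I_n.+1,
     y (n - k)%N * \prod_((n - k).+1 <= l < n.+2) t l = (-1) ^+ k.+1 * a 0 k) ->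
  trace_vector A = a.
Proof.
move=> t0 AE ya; apply/rowP => k; rewrite mxE /charcoef !subSS.
rewrite (char_poly_weighted_companion t0 AE) ?(leq_trans (leq_subr _ _)) //.
rewrite ya mulrN mulrA -exprD -signr_odd oddD /= negbK addbN addbb.
by rewrite expr1 mulN1r opprK.
Qed.

(** * The star and its edge matrix *)
Lemma prod_take (F : comNzRingType) (tau : seq nat) (j : nat) :
  (j <= size tau)%N ->
  \prod_(x <- take j tau) x%:R = \prod_(0 <= l < j) (nth 0%N tau l)%:R :> F.
Proof.
move=> js; rewrite (big_nth 0%N) size_takel //.
by apply: eq_big_nat => l /andP[_ lj]; rewrite nth_take.
Qed.

Definition axis {F : numFieldType} {n : nat} (j : nat) : 'cV[F]_n.+2 :=
  \col_l (l == j :> nat)%:R.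

Definition colours_on_line (F : numFieldType) (n : nat) (K : finType)
    (f : 'cV[F]_n.+2 -> K) (v : 'cV[F]_n.+2) : {set K} :=
  [set i | `[< exists z, f (v + z *: axis n.+1) = i >]]%SET.

(** In the next definitions a letter p = (sigma, i) names the direction of
    stage j = size sigma when the earlier multipliers are sigma and the target
    is that of colour i. The component orthogonal to the last axis is the
    nilpotent shift of the companion matrix; it does not depend on the scale
    chosen for the lines parallel to that axis, which is what allows that
    scale to be fixed first. *)
Definition shift_direction {F : numFieldType} {n : nat} {K : finType}
    (p : seq nat * K) : 'cV[F]_n.+2 :=
  if size p.1 is j.+1 then axis j else 0.

(** Up to sign, the required value of c_(n - j + 2), which is entry n - j of
    the target; the sign makes it the coefficient of x^j in
    x^(n+2) - char_poly A. *)
Definition height_coef (F : numFieldType) (n : nat) (K : finType)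
    (a : K -> 'rV[F]_n.+1) (i : K) (j : nat) : F :=
  (-1) ^+ (n - j).+1 * a i 0 (inord (n - j)).

Definition star_direction (F : numFieldType) (n : nat) (K : finType)
    (a : K -> 'rV[F]_n.+1) (c : F) (p : seq nat * K) : 'cV[F]_n.+2 :=
  shift_direction p
  + ((\prod_(x <- p.1) x%:R) / c * height_coef a p.2 (size p.1)) *: axis n.+1.

Lemma walk_star_direction (F : numFieldType) (n : nat) (K : finType)
    (a : K -> 'rV[F]_n.+1) (c : F) (v : seq (seq nat * K)) :
  exists z,
    walk (star_direction a c) v = walk shift_direction v + z *: axis n.+1.
Proof. by rewrite /walk big_split /= -scaler_suml; eexists. Qed.

(** The multipliers of the earlier stages inside y_j, the multiplier of stage
    j, and those of the later stages on the superdiagonal together form the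
    product of tau, which L / X cancels: every y_j t_(j+1) ... t_(n+1) is
    then the prescribed height coefficient, whatever tau is. *)
Lemma trace_vector_star (F : numFieldType) (n : nat) (K : finType)
    (a : K -> 'rV[F]_n.+1) (tau : seq nat) (i : K) (s X : nat) (z : F)
    (A : 'M[F]_n.+2) (L : nat) :
  L = (X * \prod_(x <- tau) x)%N ->
  size tau = n.+1 -> all (leq 1) tau -> (0 < s)%N -> (0 < X)%N ->
  (forall l j : 'I_n.+2, A l j =
     (if j == n.+1 :> nat then axis n *+ X *+ s + z *: axis n.+1
      else star_direction a (s * L)%:R (take j tau, i) *+ nth 0%N tau j) l 0) ->
  trace_vector A = a i.
Proof.
move=> LE stau tau1 s0 X0 AE.
have tau0 j : (j < n.+1)%N -> (0 < nth 0%N tau j)%N.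
  by rewrite -stau => /(all_nthP 0%N tau1).
have PE : \prod_(0 <= l < n.+1) (nth 0%N tau l)%:R
    = (\prod_(x <- tau) x)%:R :> F.
  by rewrite -prod_take ?stau // -stau take_size natr_prod.
have P0 : (\prod_(x <- tau) x)%:R != 0 :> F.
  rewrite -PE prodf_seq_neq0; apply/allP => l.
  by rewrite mem_index_iota pnatr_eq0 -lt0n => /andP[_ /tau0].
pose t l : F := if l == n.+1 then (s * X)%:R else (nth 0%N tau l)%:R.
pose y j : F := if j == n.+1 then z else
  (nth 0%N tau j)%:R
  * ((\prod_(x <- take j tau) x%:R) / (s * L)%:R * height_coef a i j).
apply: (@trace_vector_weighted_companion _ _ t y).
- move=> j; rewrite leq_eqVlt /t; case: eqP => [_ _|_ /= /tau0].
    by rewrite pnatr_eq0 -lt0n muln_gt0 s0.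
  by rewrite pnatr_eq0 -lt0n.
- move=> l j; rewrite AE /t /y.
  have [jn|jn] := eqVneq (j : nat) n.+1.
    rewrite -mulrnA !mxE mulmxnE !mxE jn eqSS.
    have [->|ln] := eqVneq (l : nat) n.+1.
      by rewrite gtn_eqF // mul0rn add0r mulr1.
    by rewrite mulr0 addr0 mulnC mulr_natr -mulrnA mulnC.
  have jn' : (j < n.+1)%N by rewrite ltn_neqAle jn -ltnS ltn_ord.
  rewrite mulmxnE !mxE /shift_direction /= size_takel ?stau 1?ltnW //.
  have [ln|ln] := eqVneq (l : nat) n.+1.
    rewrite mulr_natl; congr (_ *+ _); rewrite mulr1.
    case: (j : nat) jn' => [|j'] jn'; rewrite mxE ?add0r //.
    by rewrite ln gtn_eqF ?add0r // ltnW.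
  rewrite mulr0 addr0.
  by case: (j : nat) => [|j']; rewrite mxE ?eqSS ?mul0rn ?mul0r // mulr_natr.
move=> k; have kn : (n - k < n.+1)%N by rewrite ltnS leq_subr.
rewrite /y /= ltn_eqF // prod_take ?stau 1?ltnW //.
rewrite big_nat_recr //= {2}/t eqxx.
have -> : \prod_((n - k).+1 <= l < n.+1) t l
          = \prod_((n - k).+1 <= l < n.+1) (nth 0%N tau l)%:R.
  by apply: eq_big_nat => l /andP[_ ln]; rewrite /t ltn_eqF.
have -> : (-1) ^+ k.+1 * a i 0 k = height_coef a i (n - k).
  rewrite /height_coef subKn; last by rewrite -ltnS ltn_ord.
  by congr (_ * a i 0 _); apply/val_inj; rewrite /= inordK.
set b := height_coef _ _ _; set P1 := bigop _ _ _; set P2 := bigop _ _ _.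
have PP : P1 * (nth 0%N tau (n - k))%:R * P2 = (\prod_(x <- tau) x)%:R.
  by rewrite -PE [RHS](big_cat_nat _ _ (n := (n - k).+1)) // big_nat_recr.
have : P1 * (nth 0%N tau (n - k))%:R * P2 != 0 by rewrite PP.
have : (s * X)%:R != 0 :> F by rewrite pnatr_eq0 -lt0n muln_gt0 s0.
rewrite LE !natrM -PP !mulf_eq0 !negb_or.
move=> /andP[s1 X1] /andP[/andP[P10 x0] P20].
by field; rewrite s1 X1 P10 x0 P20.
Qed.

(** * Monochromatic tuples with prescribed traces *)

(** The target is allowed to depend on the colour, which is what makes one
    colour good for all targets at once. *)
Lemma monochromatic_trace_vector (F : numFieldType) (n : nat) (K : finType)
    (f : 'cV[F]_n.+2 -> K) (a : K -> 'rV[F]_n.+1) :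
  exists (v : 'I_n.+3 -> 'cV[F]_n.+2) (i : K),
    (forall k, f (v k) = i) /\ trace_vector (edge_matrix v) = a i.
Proof.
have [Ts [Phi [TsP nested]]] := nested_gallai K K n.+1.
pose L := (\prod_(tau <- Ts) \prod_(x <- tau) x)%N.
have tau_gt0 tau : tau \in Ts -> (0 < \prod_(x <- tau) x)%N.
  by move=> /TsP[_ /allP tau1]; rewrite big_seq prodn_cond_gt0.
have L0 : (0 < L)%N by rewrite /L big_seq prodn_cond_gt0.
(* The scale s is chosen before the star: the translates recorded in the
   profile are those of the lines through its possible base points. *)
have [B [Phi1 outer]] :=
  gallai (iota 1 L) ((size Phi).-tuple {set K} : finType).
have [v1 [s [_ /andP[s0 _] hs]]] :=
  outer _ (fun X => axis n *+ X)
    (profile shift_direction (colours_on_line f) Phi).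
set x := walk _ v1 in hs.
have [v [tau [vP tauP hv]]] :=
  nested _ (star_direction a (s * L)%:R) (fun y => f (x + y)).
have [z vz] := walk_star_direction a (s * L)%:R v.
set p0 := x + walk (star_direction a (s * L)%:R) v.
have p0E : p0 = x + walk shift_direction v + z *: axis n.+1.
  by rewrite /p0 vz addrA.
pose X := (L %/ \prod_(x <- tau) x)%N.
have LE : L = (X * \prod_(x <- tau) x)%N.
  by rewrite /X divnK // /L (big_rem tau) //= dvdn_mulr.
have X0 : (0 < X)%N by move: L0; rewrite LE muln_gt0 => /andP[].
have XL : X \in iota 1 L by rewrite mem_iota X0 add1n ltnS leq_div.
(* The moved line carries the same colours as the line of p0, in particular
   the colour of p0. *)
have [z' fz'] : exists z',
    f (x + axis n *+ X *+ s + walk shift_direction v + z' *: axis n.+1) = f p0.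
  have : f p0 \in colours_on_line f (x + walk shift_direction v).
    by rewrite inE; apply/asboolP; exists z; rewrite -p0E.
  by rewrite -(profile_eq (hs _ XL) vP) inE => /asboolP.
pose edge j := if j == n.+1 then axis n *+ X *+ s + (z' - z) *: axis n.+1
  else star_direction a (s * L)%:R (take j tau, f p0) *+ nth 0%N tau j.
exists (fun k => if k == 0 :> nat then p0 else p0 + edge k.-1), (f p0); split.
  case=> [[|j] /= jn] //; rewrite /edge; have [_|jn'] := eqVneq j n.+1.
    by rewrite -fz' p0E addrACA -scalerDl [z + _]addrC subrK (addrAC x).
  by rewrite -addrA hv // ltn_neqAle jn' -ltnS.
have [stau tau1] := TsP _ tauP.
apply: (trace_vector_star (z := z' - z) LE stau tau1 s0 X0) => l j.
by rewrite mxE /= [p0 + _]addrC addrK.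
Qed.

Theorem theorem1 (R : realType) (d : nat) (hd : (2 <= d)%N) (r : nat)
    (C : 'I_r -> set 'cV[R]_d)
    (Cdisj : trivIset [set: 'I_r] C)
    (Ccover : \bigcup_(i in [set: 'I_r]) C i = [set: 'cV[R]_d]) :
  exists i0 : 'I_r, TraceSpec (C i0) = [set: 'rV[R]_d.-1].
Proof.
case: d hd C Cdisj Ccover => [//|[//|n]] _ C _ Ccover.
have /choice[f fP] : forall x, exists i, C i x.
  move=> x; have : [set: 'cV[R]_n.+2] x by [].
  by rewrite -Ccover => -[i _ Cx]; exists i.
apply: contrapT => /forallNP noC.
have /choice[a aP] : forall i, exists b : 'rV[R]_n.+1, ~ TraceSpec (C i) b.
  move=> i; apply: contrapT => /forallNP allb; apply: (noC i).
  by apply/seteqP; split=> // b _; apply: contrapT; exact: allb.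
have [v [i [fv va]]] := monochromatic_trace_vector f a.
by apply: (aP i); exists v => // k; rewrite -(fv k).
Qed.
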